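(* Let $f:[0,\infty)\to\mathbb{R}$ be a convex function with $f(0)\le 0$. Then for any $m\in\mathbb{N}$ (with $m \ge 1$) and any real numbers $a_1\ge a_2\ge\dots\ge a_m\ge 0$, $$ f\left(\sum_{s=1}^{m}(-1)^{s-1}a_s\right)\le \sum_{s=1}^{m}(-1)^{s-1}f(a_s). $$ *)

(* Defs.v *)
From HB Require Import structures.
From mathcomp Require Export all_boot all_order all_algebra.
From mathcomp Require Export mathcomp_extra boolp classical_sets set_interval.
From mathcomp Require Export reals convex.

(* Main.v *)
Require Import Defs.
From mathcomp Require Import interval_inference ring lra.
Import Order.TTheory GRing.Theory Num.Theory.
Local Open Scope classical_set_scope.
Local Open Scope ring_scope.

(** Since the sequence decreases to a nonnegative value, an alternating sum
starting at its third term lies between [0] and that term. Writing [S] for the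
whole alternating sum and [T] for the one from the third term on, this gives
[S = a1 - a2 + T] with [0 <= T <= a2 <= a1].

Now [S] and [a2] both lie in the interval from [T] to [a1] and have the same sum
as its endpoints, and a convex function has the larger sum at the endpoints:
[f S + f a2 <= f a1 + f T] ([convex_exchange]). Hence
[f S <= f a1 - f a2 + f T], and [T] has two terms fewer than [S], so induction
by steps of two concludes. It bottoms out either at a single term, with
equality, or at the empty sum, where [f 0 <= 0] is what is required. *)

(** The point [z] is a convex combination of [x] and [y]; the combination with
the two weights exchanged is the mirror image [x - z + y], so adding the two
convexity inequalities makes the weights sum to [1]. *)
Lemma convex_exchange (R : realFieldType) (f : R -> R) (D : set R^o)
    (f_convex : convex_function D f) (x y z : R) :
  x \in D -> y \in D -> y <= z -> z <= x ->
  f (x - z + y) + f z <= f x + f y.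
Proof.
move=> xD yD yz zx.
have [xy|yx] := leP x y.
  have zy : z = y by lra.
  have xz : x = z by lra.
  by rewrite xz subrr add0r addrC.
have d_gt0 : 0 < x - y by rewrite subr_gt0.
pose t := (z - y) / (x - y).
have t_ge0 : 0 <= t by rewrite divr_ge0 ?subr_ge0 // ltW.
have t_le1 : t <= 1 by rewrite ler_pdivrMr // mul1r lerD2r.
have td : t * (x - y) = z - y by rewrite divfK // gt_eqF.
have f_mix u v : u \in D -> v \in D ->
    f (t * u + (1 - t) * v) <= t * f u + (1 - t) * f v.
  exact: (f_convex (Itv01 t_ge0 t_le1)).
have := f_mix y x yD xD; have := f_mix x y xD yD.
have -> : t * x + (1 - t) * y = z.
  by transitivity (y + t * (x - y)); [ring|rewrite td; ring].
have -> : t * y + (1 - t) * x = x - z + y.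
  by transitivity (x - t * (x - y)); [ring|rewrite td; ring].
lra.
Qed.

Lemma alternating_sum_recl (R : pzRingType) (n : nat) (b : nat -> R) :
  \sum_(i < n.+1) (-1) ^+ i * b i
    = b 0 - \sum_(i < n) (-1) ^+ i * b i.+1.
Proof.
rewrite big_ord_recl expr0 mul1r -sumrN; congr (_ + _).
by apply: eq_bigr => i _; rewrite exprS mulN1r mulNr.
Qed.

(** Splitting off [b 0] leaves [b 0] minus an alternating sum that, inductively,
lies between [0] and [b 1 <= b 0]. *)
Lemma alternating_sum_bounds (R : realDomainType) (n : nat) (b : nat -> R) :
  (forall i, b i.+1 <= b i) -> (forall i, 0 <= b i) ->
  0 <= \sum_(i < n) (-1) ^+ i * b i <= b 0.
Proof.
elim: n b => [|n IHn] b b_noninc b_ge0.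
  by rewrite big_ord0 lexx b_ge0.
have /andP[T_ge0 T_le] := IHn (b \o S) (fun i => b_noninc i.+1)
  (fun i => b_ge0 i.+1).
rewrite alternating_sum_recl subr_ge0 gerBl T_ge0 andbT.
exact: le_trans T_le (b_noninc 0).
Qed.

Lemma convex_alternating_sum_le (R : realType) (f : R -> R)
    (f_convex : convex_function (`[0, +oo[ : set R^o) f) (f0 : f 0 <= 0)
    (n : nat) (b : nat -> R) :
  (forall i, b i.+1 <= b i) -> (forall i, 0 <= b i) ->
  f (\sum_(i < n) (-1) ^+ i * b i) <= \sum_(i < n) (-1) ^+ i * f (b i).
Proof.
elim/ltn_ind: n b => -[|[|n]] IHn b b_noninc b_ge0.
- by rewrite !big_ord0.
- by rewrite !big_ord1 !expr0 !mul1r.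
have peel2 (c : nat -> R) : \sum_(i < n.+2) (-1) ^+ i * c i
    = c 0 - c 1 + \sum_(i < n) (-1) ^+ i * c i.+2.
  rewrite alternating_sum_recl (alternating_sum_recl _ _ (fun i => c i.+1)).
  by rewrite opprB addrA addrAC.
rewrite peel2 (peel2 (f \o b)) /=.
have b2_noninc i : b i.+3 <= b i.+2 by [].
have b2_ge0 i : 0 <= b i.+2 by [].
have /andP[T_ge0 T_le] :=
  alternating_sum_bounds R n (fun i => b i.+2) b2_noninc b2_ge0.
have fT_le := IHn n (leqnSn n.+1) (fun i => b i.+2) b2_noninc b2_ge0.
have in_itv0 (x : R) : 0 <= x -> x \in (`[0, +oo[%classic : set R^o).
  by move=> x_ge0; rewrite inE /= in_itv /= x_ge0.
have exchange := convex_exchange R f _ f_convex _ _ (b 1) (in_itv0 _ (b_ge0 0))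
  (in_itv0 _ T_ge0) (le_trans T_le (b_noninc 1)) (b_noninc 0).
by move: exchange fT_le => /=; lra.
Qed.

(* f is a total function of which only the values on [0, +oo[ matter, and
   a 1, ..., a m are the m given reals (other values of a are irrelevant). *)
Theorem theorem2p16 (R : realType) (f : R -> R)
    (f_convex : convex_function (`[0, +oo[ : set R^o) f)
    (f0 : f 0 <= 0)
    (m : nat) (m_ge1 : (1 <= m)%N)
    (a : nat -> R)
    (a_noninc : forall s : nat, (1 <= s)%N -> (s < m)%N -> a s.+1 <= a s)
    (am_ge0 : 0 <= a m) :
  f (\sum_(1 <= s < m.+1) (-1) ^+ (s - 1) * a s)
    <= \sum_(1 <= s < m.+1) (-1) ^+ (s - 1) * f (a s).
Proof.
(* Freezing the sequence at its last term makes it monotone everywhere. *)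
pose b i := a (minn i.+1 m).
have b_noninc i : b i.+1 <= b i.
  rewrite /b; have [lt_im|le_mi] := ltnP i.+1 m.
    by rewrite (minn_idPl lt_im); apply: a_noninc.
  by rewrite (minn_idPr (leqW le_mi)).
have b_ge0 i : 0 <= b i.
  have b_ge k : b (k + i)%N <= b i.
    by elim: k => // k; apply: le_trans; rewrite addSn.
  apply: le_trans (b_ge m); rewrite /b (minn_idPr _) //.
  by rewrite -addnS leq_addr.
have sum_b (g : R -> R) : \sum_(1 <= s < m.+1) (-1) ^+ (s - 1) * g (a s)
    = \sum_(i < m) (-1) ^+ i * g (b i).
  rewrite big_add1 big_mkord; apply: eq_bigr => i _.
  by rewrite subn1 /b (minn_idPl (ltn_ord i)).
rewrite (sum_b f) (sum_b id).
exact: convex_alternating_sum_le.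
Qed.
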